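(* Let $\omega_0>0$ and $a_0>0$. For $\varepsilon>0$ let $u_\varepsilon$ be the solution of $$\ddot u+\omega_0^2u+\varepsilon u_+=0,\qquad u_\varepsilon(0)=a_0,\quad\dot u_\varepsilon(0)=0.$$ Set $\displaystyle\omega_\varepsilon=\omega_0+\frac{\varepsilon}{4\omega_0}-\frac{\varepsilon^2}{(2\omega_0)^3}$ and $$v_1(s)=\frac{-a_0}{\pi\omega_0^2}\left(1-\cos(s)+2\sum_{k=1}^{+\infty}\frac{(-1)^k}{(4k^2-1)^2}\big(\cos(2ks)-\cos(s)\big)\right).$$ Then there exists $\gamma>0$ such that, with $T_\varepsilon=\gamma\varepsilon^{-1}$, $$u_\varepsilon(t)=a_0\cos(\omega_\varepsilon t)+\varepsilon v_1(\omega_\varepsilon t)+\mathcal{O}(\varepsilon^2)\qquad\text{in }C^2([0,T_\varepsilon],\mathbb{R}).$$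
   Context: For real $x$, $x_+=\max(0,x)$. The notation $\mathcal{O}(\varepsilon^2)$ in $C^2([0,T_\varepsilon],\mathbb{R})$ means a function whose $C^2$ norm on $[0,T_\varepsilon]$ is at most $C\varepsilon^2$ for all sufficiently small $\varepsilon>0$, with $C$ independent of $\varepsilon$. *)

(* Defs.v *)
(* Classical reals of the standard library, with Coquelicot. *)
From Stdlib Require Import Reals.
From Coquelicot Require Import Coquelicot.
Open Scope R_scope.

Definition pos_part (x : R) : R := Rmax 0 x.

(* The equation is autonomous with a globally Lipschitz nonlinearity, so its
   maximal solution is defined on the whole real line. *)
Definition is_solution (omega0 a0 eps : R) (u : R -> R) : Prop :=
  (forall t : R, ex_derive u t) /\
  (forall t : R, ex_derive (Derive u) t) /\
  (forall t : R,
     Derive (Derive u) t + omega0 ^ 2 * u t + eps * pos_part (u t) = 0) /\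
  u 0 = a0 /\
  Derive u 0 = 0.

Definition omega (omega0 eps : R) : R :=
  omega0 + eps / (4 * omega0) - eps ^ 2 / (2 * omega0) ^ 3.

Definition v1_term (s : R) (k : nat) : R :=
  (-1) ^ k / (4 * INR k ^ 2 - 1) ^ 2 * (cos (2 * INR k * s) - cos s).

(* [Series] starts at index 0, whereas the sum here starts at k = 1. *)
Definition v1 (omega0 a0 s : R) : R :=
  - a0 / (PI * omega0 ^ 2) *
  (1 - cos s + 2 * Series (fun k : nat => v1_term s (S k))).

(* For a function given on the whole line; derivatives at the endpoints are
   two-sided, which is at least as strong as C^2 of the restriction to [a, b]. *)
Definition C2_on (a b : R) (f : R -> R) : Prop :=
  forall (k : nat) (t : R), (k <= 2)%nat -> a <= t <= b ->
    ex_derive_n f k t /\ continuous (Derive_n f k) t.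

(* max_{k <= 2} sup_{[a, b]} |f^(k)|, valued in [Rbar] so that an unbounded
   function has norm [p_infty]. *)
Definition C2_norm (a b : R) (f : R -> R) : Rbar :=
  Lub_Rbar (fun y : R => exists (k : nat) (t : R),
    (k <= 2)%nat /\ a <= t <= b /\ y = Rabs (Derive_n f k t)).

(* [r eps] is O(eps^2) in C^2([0, T eps]) as eps -> 0+. *)
Definition O_eps2_in_C2 (T : R -> R) (r : R -> R -> R) : Prop :=
  exists C eps0 : R, 0 < eps0 /\
    forall eps : R, 0 < eps < eps0 ->
      C2_on 0 (T eps) (r eps) /\
      Rbar_le (C2_norm 0 (T eps) (r eps)) (Finite (C * eps ^ 2)).

(* Main.v *)
Require Import Defs.
From Stdlib Require Import Reals Lra Lia Ratan.
From Coquelicot Require Import Coquelicot.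
Open Scope R_scope.

(** The proof combines an approximation over one period with an exact knowledge
    of the period.

    The profile V(s) = a0 cos s + eps v1(s) is chosen so that t |-> V(omega t)
    solves the equation up to a residual O(eps^2), uniformly in time. This rests
    on the forced oscillator v1'' + v1 = - a0 / (2 omega0^2) |cos s| with
    v1(0) = v1'(0) = 0 ([v1_forced_oscillator]), which is the Fourier expansion
    of |cos s| ([abs_cos_fourier]) after dividing its coefficients by 1 - 4k^2:
    the terms of order eps in the residual then add up to
    eps a0 (cos_+ - cos / 2 - |cos| / 2) = 0 ([residual_bound]).

    A Gronwall estimate ([gronwall_oscillator]) turns this residual into an error
    O(eps^2) for u on a bounded time interval, but over times of order 1 / eps it
    would only give O(eps). The long times are reached through periodicity: the
    equation is linear on each side of u = 0, so u has exactly the period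
    P = pi / omega0 + pi / sqrt(omega0^2 + eps) ([solution_periodic]), and the
    given frequency satisfies omega P = 2 pi + O(eps^3)
    ([omega_period_expansion]). Writing t = tau + n P with tau in [0, P], the
    solution is unchanged by the shift n P, whereas V(omega t) moves by at most
    n O(eps^3) = O(eps^2), because n = O(1 / eps) and V is Lipschitz.

    Finally the sup-norm estimate carries over to two derivatives: the equation
    satisfied by the error bounds its second derivative, and a Landau type
    inequality on [t, t + 1] bounds the first one. Any gamma would do; the proof
    takes gamma = 1 and estimates the error on [0, 2 / eps], which leaves room
    for the interval [t, t + 1]. *)

(** * Termwise differentiation of trigonometric series *)

Lemma ex_series_Rabs_le (a b : nat -> R) :
  (forall k, Rabs (a k) <= b k) -> ex_series b ->
  ex_series (fun k => Rabs (a k)).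
Proof.
intros Hab Hb.
apply (@ex_series_le R_AbsRing R_CompleteNormedModule _ b); [|exact Hb].
intro k; unfold norm; simpl; unfold abs; simpl.
rewrite Rabs_Rabsolu; apply Hab.
Qed.

(** The M-test, in the form needed by [CVU_derivable]; the remainder is bounded
    by the tail of [b] independently of [s]. *)
Lemma weierstrass_CVU (g : nat -> R -> R) (b : nat -> R) (c : R) (r : posreal) :
  (forall k s, Rabs (g k s) <= b k) -> ex_series b ->
  CVU (fun n s => sum_f_R0 (fun k => g k s) n)
      (fun s => Series (fun k => g k s)) c r.
Proof.
intros Hg Hb e He.
destruct Hb as [l Hl].
assert (Hs : ex_series b) by (exists l; exact Hl).
pose proof (proj1 (is_series_Reals b l) Hl e He) as [N HN].
exists N; intros n s Hn _.
assert (Ha : ex_series (fun k => Rabs (g k s))).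
{ apply (ex_series_Rabs_le _ b); [intro k; apply Hg | exact Hs]. }
rewrite (Series_incr_n (fun k => g k s) (S n)) by
  (try lia; apply ex_series_Rabs; exact Ha).
simpl Init.Nat.pred.
replace (_ + _ - _) with (Series (fun k => g (S n + k)%nat s)) by ring.
apply Rle_lt_trans with (Series (fun k => Rabs (g (S n + k)%nat s))).
{ apply Series_Rabs.
  apply (ex_series_incr_n (fun k => Rabs (g k s)) (S n)); exact Ha. }
apply Rle_lt_trans with (Series (fun k => b (S n + k)%nat)).
{ apply Series_le.
  - intro k; split; [apply Rabs_pos | apply Hg].
  - apply (ex_series_incr_n b (S n)); exact Hs. }
specialize (HN n Hn).
unfold Rdist in HN.
rewrite <- (is_series_unique b l Hl) in HN.
rewrite (Series_incr_n b (S n)) in HN by (try lia; exact Hs).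
simpl Init.Nat.pred in HN.
apply Rabs_def2 in HN; lra.
Qed.

(** The phase makes the family closed under differentiation: sines are cosines
    shifted by a quarter turn. *)
Definition trig_series (a p : nat -> R) (phi s : R) : R :=
  Series (fun k => a k * cos (p k * s + phi)).

Lemma Rabs_mul_cos_le (a x : R) : Rabs (a * cos x) <= Rabs a.
Proof.
rewrite Rabs_mult.
assert (Rabs (cos x) <= 1) by (apply Rabs_le; apply COS_bound).
pose proof (Rabs_pos a); nra.
Qed.

Lemma ex_series_trig (a p : nat -> R) (phi s : R) :
  ex_series (fun k => Rabs (a k)) ->
  ex_series (fun k => a k * cos (p k * s + phi)).
Proof.
intro H; apply ex_series_Rabs, ex_series_Rabs_le with (2 := H).
intro k; apply Rabs_mul_cos_le.
Qed.

Lemma trig_series_bound (a p : nat -> R) (phi s : R) :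
  ex_series (fun k => Rabs (a k)) ->
  Rabs (trig_series a p phi s) <= Series (fun k => Rabs (a k)).
Proof.
intro H.
assert (H' : ex_series (fun k => Rabs (a k * cos (p k * s + phi)))).
{ apply ex_series_Rabs_le with (2 := H); intro k; apply Rabs_mul_cos_le. }
unfold trig_series; eapply Rle_trans; [apply Series_Rabs; exact H'|].
apply Series_le; [|exact H].
intro k; split; [apply Rabs_pos | apply Rabs_mul_cos_le].
Qed.

Lemma is_derive_trig_series (a p : nat -> R) (phi s : R) :
  ex_series (fun k => Rabs (a k)) ->
  ex_series (fun k => Rabs (a k * p k)) ->
  is_derive (trig_series a p phi) s
    (trig_series (fun k => a k * p k) p (phi + PI / 2) s).
Proof.
intros H0 H1.
apply is_derive_Reals.
apply (CVU_derivable
  (fun n s => sum_f_R0 (fun k => a k * cos (p k * s + phi)) n)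
  (fun n s => sum_f_R0 (fun k => a k * p k * cos (p k * s + (phi + PI / 2))) n)
  _ (trig_series (fun k => a k * p k) p (phi + PI / 2)) s (mkposreal 1 Rlt_0_1)).
- apply (weierstrass_CVU
    (fun k s => a k * p k * cos (p k * s + (phi + PI / 2))) _ _ _
    (fun k s => Rabs_mul_cos_le _ _) H1).
- intros x _.
  apply is_series_Reals, Series_correct, ex_series_trig, H0.
- intros n x _.
  apply is_derive_Reals.
  assert (Hk : forall k, is_derive (fun s => a k * cos (p k * s + phi)) x
             (a k * p k * cos (p k * x + (phi + PI / 2)))).
  { intro k.
    replace (cos (p k * x + (phi + PI / 2))) with (- sin (p k * x + phi)).
    - auto_derive; [trivial | ring].
    - rewrite sin_cos, Ropp_involutive; f_equal; ring. }
  induction n as [|n IH]; simpl; [apply Hk|].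
  apply (is_derive_plus (K := R_AbsRing) (V := R_NormedModule)); [exact IH | apply Hk].
- unfold Boule; simpl; rewrite Rminus_diag, Rabs_R0; lra.
Qed.

(** * Fourier expansion of |cos s| *)

Definition freq (k : nat) : R := 2 * INR (S k).

(** With m = k + 1 this is 4 m^2 - 1, the detuning of the m-th even harmonic from
    the free oscillator y'' + y = 0. *)
Definition gap (k : nat) : R := freq k ^ 2 - 1.

Lemma freq_ge_2 (k : nat) : 2 <= freq k.
Proof. unfold freq; rewrite S_INR; pose proof (pos_INR k); lra. Qed.

Lemma gap_ge (k : nat) : 3 <= gap k /\ freq k <= gap k /\ freq k ^ 2 <= 2 * gap k.
Proof. unfold gap; pose proof (freq_ge_2 k); nra. Qed.

(** The sum telescopes, since 2 / (4 m^2 - 1) = 1 / (2m - 1) - 1 / (2m + 1). *)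
Lemma sum_inv_gap (n : nat) :
  sum_f_R0 (fun k => / gap k) n = / 2 - / 2 * / (2 * INR n + 3).
Proof.
induction n as [|n IH]; [unfold gap, freq; simpl; field|].
simpl sum_f_R0; rewrite IH; unfold gap, freq; rewrite !S_INR.
pose proof (pos_INR n); field; repeat split; nra.
Qed.

Lemma is_lim_seq_inv_odd (c : R) : is_lim_seq (fun n => c * / (2 * INR n + 3)) 0.
Proof.
replace (Finite 0) with (Rbar_mult c 0) by (simpl; f_equal; ring).
apply is_lim_seq_scal_l.
replace (Finite 0) with (Rbar_inv p_infty) by reflexivity.
apply is_lim_seq_inv; [|discriminate].
apply is_lim_seq_le_p_loc with INR; [|apply is_lim_seq_INR].
exists 0%nat; intros n _; pose proof (pos_INR n); lra.
Qed.

Lemma ex_series_inv_gap : ex_series (fun k => / gap k).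
Proof.
exists (/ 2).
change (is_lim_seq (sum_n (fun k => / gap k)) (/ 2)).
apply (is_lim_seq_ext (fun n => / 2 - / 2 * / (2 * INR n + 3))).
{ intro n; rewrite sum_n_Reals, sum_inv_gap; reflexivity. }
replace (Finite (/ 2)) with (Finite (/ 2 - 0)) by (f_equal; ring).
apply is_lim_seq_minus'; [apply is_lim_seq_const | apply is_lim_seq_inv_odd].
Qed.

Lemma ex_series_gap_bound (a : nat -> R) (c : R) :
  (forall k, Rabs (a k) <= c * / gap k) -> ex_series (fun k => Rabs (a k)).
Proof.
intro H; apply ex_series_Rabs_le with (1 := H).
apply (ex_series_scal (V := R_NormedModule) c), ex_series_inv_gap.
Qed.

Definition sgn_gap (k : nat) : R := (-1) ^ k * / gap k.

Fixpoint abs_cos_sum (n : nat) (s : R) : R :=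
  match n with
  | O => / 2
  | S k => abs_cos_sum k s + sgn_gap k * cos (freq k * s + 0)
  end.

Definition abs_cos_series (s : R) : R := / 2 + trig_series sgn_gap freq 0 s.

Lemma Rabs_sgn_gap (k : nat) : Rabs (sgn_gap k) = / gap k.
Proof.
unfold sgn_gap; rewrite Rabs_mult, pow_1_abs, Rmult_1_l.
apply Rabs_pos_eq, Rlt_le, Rinv_0_lt_compat; pose proof (gap_ge k); lra.
Qed.

Lemma ex_series_sgn_gap : ex_series (fun k => Rabs (sgn_gap k)).
Proof.
apply (ex_series_gap_bound _ 1); intro k; rewrite Rabs_sgn_gap; lra.
Qed.

Lemma abs_cos_sum_lim (s : R) :
  is_lim_seq (fun n => abs_cos_sum n s) (abs_cos_series s).
Proof.
apply is_lim_seq_incr_1.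
apply is_lim_seq_ext
  with (fun n => / 2 + sum_n (fun k => sgn_gap k * cos (freq k * s + 0)) n).
{ intro n; rewrite sum_n_Reals.
  induction n as [|n IH]; [reflexivity|].
  simpl sum_f_R0; rewrite <- Rplus_assoc, IH; reflexivity. }
apply is_lim_seq_plus'; [apply is_lim_seq_const|].
exact (Series_correct _ (ex_series_trig _ freq 0 s ex_series_sgn_gap)).
Qed.

(** The left-hand side is the Wronskian of cos with a partial sum. Writing q for
    freq n, the next term contributes
    - (-1)^n (sin((q+1)s) / (q+1) + sin((q-1)s) / (q-1)) / 2,
    so the contributions telescope to an explicit quantity of order 1 / n, and in
    the limit the Wronskian vanishes. *)
Lemma abs_cos_sum_wronskian (n : nat) (s : R) :
  exists d, is_derive (abs_cos_sum n) s d /\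
    d * cos s + abs_cos_sum n s * sin s =
      (-1) ^ n * sin ((2 * INR n + 1) * s) * / (2 * (2 * INR n + 1)).
Proof.
induction n as [|n [d [Hd E]]].
{ exists 0; split; [apply (is_derive_const (K := R_AbsRing) (V := R_NormedModule))|].
  simpl; replace ((2 * 0 + 1) * s) with s by ring; field. }
exists (d + - sgn_gap n * freq n * sin (freq n * s)); split.
{ apply (is_derive_plus (K := R_AbsRing) (V := R_NormedModule)); [exact Hd|].
  auto_derive; [trivial | rewrite Rplus_0_r; ring]. }
simpl abs_cos_sum; rewrite Rplus_0_r, S_INR.
set (m := freq n * s).
replace ((2 * (INR n + 1) + 1) * s) with (m + s)
  by (unfold m, freq; rewrite S_INR; ring).
replace ((2 * INR n + 1) * s) with (m - s) in E
  by (unfold m, freq; rewrite S_INR; ring).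
rewrite sin_minus in E; rewrite sin_plus.
transitivity ((d * cos s + abs_cos_sum n s * sin s) +
  sgn_gap n * (cos m * sin s - freq n * sin m * cos s)); [ring|].
rewrite E; unfold sgn_gap, gap, freq; rewrite S_INR; simpl pow.
pose proof (pos_INR n); field; repeat split; nra.
Qed.

(** At 0 the partial fractions of 1 / gap turn the partial sums into those of the
    Leibniz series for pi / 4, with half of the last term. *)
Lemma abs_cos_sum_0 (n : nat) :
  abs_cos_sum n 0 = sum_f_R0 (tg_alt PI_tg) n - / 2 * tg_alt PI_tg n.
Proof.
induction n as [|n IH].
{ unfold tg_alt, PI_tg; simpl; field. }
simpl abs_cos_sum; simpl sum_f_R0; rewrite IH.
rewrite Rmult_0_r, Rplus_0_r, cos_0.
unfold tg_alt, PI_tg, sgn_gap, gap, freq.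
rewrite !plus_INR, !mult_INR, !S_INR; simpl.
pose proof (pos_INR n); field; repeat split; nra.
Qed.

Lemma abs_cos_series_0 : abs_cos_series 0 = PI / 4.
Proof.
assert (H := is_lim_seq_unique _ _ (abs_cos_sum_lim 0)).
assert (HL : is_lim_seq (fun n => sum_f_R0 (tg_alt PI_tg) n) (PI / 4)).
{ apply is_lim_seq_Reals; rewrite <- Alt_PI_eq; unfold Alt_PI.
  destruct exist_PI as [l Hl]; replace (4 * l / 4) with l by field; exact Hl. }
assert (HT : is_lim_seq (tg_alt PI_tg) 0).
{ apply is_lim_seq_incr_1.
  apply is_lim_seq_ext
    with (fun n => sum_f_R0 (tg_alt PI_tg) (S n) - sum_f_R0 (tg_alt PI_tg) n).
  { intro n; simpl; ring. }
  replace 0 with (PI / 4 - PI / 4) by ring.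
  apply is_lim_seq_minus'; [|exact HL].
  apply (is_lim_seq_incr_1 (fun n => sum_f_R0 (tg_alt PI_tg) n)); exact HL. }
assert (HZ : is_lim_seq (fun n => abs_cos_sum n 0) (PI / 4 - / 2 * 0)).
{ apply is_lim_seq_ext
    with (fun n => sum_f_R0 (tg_alt PI_tg) n - / 2 * tg_alt PI_tg n).
  { intro n; rewrite abs_cos_sum_0; reflexivity. }
  apply is_lim_seq_minus'; [exact HL|].
  apply (is_lim_seq_scal_l _ (/ 2) 0); exact HT. }
apply is_lim_seq_unique in HZ; rewrite H in HZ; injection HZ; lra.
Qed.

Lemma cos_add_INR_PI (x : R) (n : nat) : cos (x + INR n * PI) = (-1) ^ n * cos x.
Proof.
induction n as [|n IH]; [simpl; rewrite Rmult_0_l, Rplus_0_r; ring|].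
rewrite S_INR; replace (x + (INR n + 1) * PI) with (x + INR n * PI + PI) by ring.
rewrite neg_cos, IH; simpl; ring.
Qed.

(** The Wronskian argument degenerates where cos vanishes; there the sum
    telescopes instead. *)
Lemma abs_cos_series_PI2 : abs_cos_series (PI / 2) = 0.
Proof.
assert (H := is_lim_seq_unique _ _ (abs_cos_sum_lim (PI / 2))).
assert (E : forall n, abs_cos_sum (S n) (PI / 2) = / 2 * / (2 * INR n + 3)).
{ intro n.
  replace (/ 2 * / (2 * INR n + 3))
    with (/ 2 - sum_f_R0 (fun k => / gap k) n) by (rewrite sum_inv_gap; ring).
  assert (T : forall k, sgn_gap k * cos (freq k * (PI / 2) + 0) = - / gap k).
  { intro k; unfold freq.
    replace (2 * INR (S k) * (PI / 2) + 0) with (0 + INR (S k) * PI) by field.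
    rewrite cos_add_INR_PI, cos_0; unfold sgn_gap; simpl.
    transitivity (- ((-1) ^ k * (-1) ^ k) * / gap k); [ring|].
    rewrite <- Rpow_mult_distr; replace (-1 * -1) with 1 by ring.
    rewrite pow1; ring. }
  induction n as [|n IH]; simpl abs_cos_sum; simpl sum_f_R0;
    [|simpl abs_cos_sum in IH; rewrite IH]; rewrite T; ring. }
assert (HZ : is_lim_seq (fun n => abs_cos_sum n (PI / 2)) 0).
{ apply is_lim_seq_incr_1.
  apply is_lim_seq_ext with (fun n => / 2 * / (2 * INR n + 3)).
  { intro n; rewrite E; reflexivity. }
  apply is_lim_seq_inv_odd. }
apply is_lim_seq_unique in HZ; rewrite H in HZ; injection HZ; trivial.
Qed.

(** The derivative of the quotient by cos is the Wronskian divided by cos^2, so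
    the mean value theorem applies on [0, s], where cos is bounded below by
    cos s. *)
Lemma abs_cos_sum_near_cos (n : nat) (s : R) : 0 <= s < PI / 2 ->
  Rabs (abs_cos_sum n s - abs_cos_sum n 0 * cos s) <= s * / cos s * / (2 * INR n + 1).
Proof.
intros [Hs0 Hs].
assert (Hc : forall x, 0 <= x <= s -> 0 < cos s <= cos x).
{ intros x Hx; split; [apply cos_gt_0; lra|].
  apply cos_decr_1; lra. }
set (df := fun x => Derive (fun y : R => abs_cos_sum n y / cos y) x).
assert (Hdf : forall x, 0 <= x <= s ->
  is_derive (fun y : R => abs_cos_sum n y / cos y) x (df x) /\
  Rabs (df x) <= / (2 * INR n + 1) * / (cos s * cos s)).
{ intros x Hx; destruct (abs_cos_sum_wronskian n x) as [d [Hd E]].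
  pose proof (Hc x Hx); pose proof (pos_INR n).
  assert (Q : is_derive (fun y : R => abs_cos_sum n y / cos y) x
                ((d * cos x + abs_cos_sum n x * sin x) / (cos x * cos x))).
  { replace (_ / _) with ((d * cos x - abs_cos_sum n x * (- sin x)) / cos x ^ 2)
      by (field; lra).
    apply is_derive_div; [exact Hd | auto_derive; [trivial|ring] | lra]. }
  assert (Hdx : df x = (d * cos x + abs_cos_sum n x * sin x) / (cos x * cos x))
    by exact (is_derive_unique _ _ _ Q).
  rewrite Hdx; split; [exact Q|]; rewrite E.
  unfold Rdiv; rewrite !Rabs_mult, pow_1_abs, Rmult_1_l.
  assert (B : Rabs (sin ((2 * INR n + 1) * x)) <= 1)
    by (apply Rabs_le, SIN_bound).
  assert (P1 : 0 < / (2 * INR n + 1)) by (apply Rinv_0_lt_compat; lra).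
  rewrite (Rabs_pos_eq (/ (2 * (2 * INR n + 1))))
    by (apply Rlt_le, Rinv_0_lt_compat; lra).
  rewrite (Rabs_pos_eq (/ (cos x * cos x)))
    by (apply Rlt_le, Rinv_0_lt_compat; nra).
  assert (/ (cos x * cos x) <= / (cos s * cos s))
    by (apply Rinv_le_contravar; nra).
  assert (0 < / (cos x * cos x)) by (apply Rinv_0_lt_compat; nra).
  apply Rmult_le_compat; try lra.
  - apply Rmult_le_pos; [apply Rabs_pos|].
    apply Rlt_le, Rinv_0_lt_compat; lra.
  - rewrite Rinv_mult; pose proof (Rabs_pos (sin ((2 * INR n + 1) * x))); nra. }
destruct (MVT_gen (fun x => abs_cos_sum n x / cos x) 0 s df) as [c [Hc' E]].
- rewrite Rmin_left, Rmax_right by lra; intros x Hx; apply Hdf; lra.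
- rewrite Rmin_left, Rmax_right by lra; intros x Hx.
  apply derivable_continuous_pt; exists (df x).
  apply is_derive_Reals, Hdf; lra.
- rewrite Rmin_left, Rmax_right in Hc' by lra.
  destruct (Hdf c Hc') as [_ Hb].
  pose proof (Hc s ltac:(lra)) as [Hcs _].
  rewrite cos_0 in E.
  replace (abs_cos_sum n s - abs_cos_sum n 0 * cos s) with
    (cos s * (abs_cos_sum n s / cos s - abs_cos_sum n 0 / 1)) by (field; lra).
  rewrite E, !Rabs_mult, Rminus_0_r, (Rabs_pos_eq (cos s)), (Rabs_pos_eq s) by lra.
  replace (s * / cos s * / (2 * INR n + 1)) with
    (cos s * ((/ (2 * INR n + 1) * / (cos s * cos s)) * s))
    by (pose proof (pos_INR n); field; lra).
  apply Rmult_le_compat_l; [lra|]; apply Rmult_le_compat_r; lra.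
Qed.

Lemma abs_cos_series_quarter (s : R) : 0 <= s <= PI / 2 ->
  abs_cos_series s = PI / 4 * cos s.
Proof.
intros [Hs0 Hs].
destruct (Req_dec s (PI / 2)) as [->|Hne].
{ rewrite abs_cos_series_PI2, cos_PI2; ring. }
assert (L : is_lim_seq (fun n => abs_cos_sum n s - abs_cos_sum n 0 * cos s)
              (abs_cos_series s - abs_cos_series 0 * cos s)).
{ apply is_lim_seq_minus'; [apply abs_cos_sum_lim|].
  apply (is_lim_seq_scal_r _ (cos s) (abs_cos_series 0)), abs_cos_sum_lim. }
assert (L0 : is_lim_seq (fun n => abs_cos_sum n s - abs_cos_sum n 0 * cos s) 0).
{ apply is_lim_seq_abs_0, is_lim_seq_le_le
    with (u := fun _ => 0) (w := fun n => s * / cos s * / (2 * INR n + 1)).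
  - intro n; split; [apply Rabs_pos | apply abs_cos_sum_near_cos; lra].
  - apply is_lim_seq_const.
  - apply is_lim_seq_incr_1.
    apply is_lim_seq_ext with (fun n => s * / cos s * / (2 * INR n + 3)).
    { intro n; rewrite S_INR; f_equal; f_equal; ring. }
    apply is_lim_seq_inv_odd. }
apply is_lim_seq_unique in L; apply is_lim_seq_unique in L0.
rewrite L in L0; injection L0; rewrite abs_cos_series_0; lra.
Qed.

Lemma cos_freq_add_PI (k n : nat) (s phi : R) :
  cos (freq k * (s + INR n * PI) + phi) = cos (freq k * s + phi).
Proof.
unfold freq.
replace (2 * INR (S k) * (s + INR n * PI) + phi)
  with (2 * INR (S k) * s + phi + 2 * INR (S k * n) * PI)
  by (rewrite mult_INR; ring).
apply cos_period.
Qed.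

Lemma trig_series_freq_periodic (a : nat -> R) (n : nat) (phi s : R) :
  trig_series a freq phi (s + INR n * PI) = trig_series a freq phi s.
Proof.
apply Series_ext; intro k; rewrite cos_freq_add_PI; reflexivity.
Qed.

(** This is |cos s| = 2 / pi + (4 / pi) sum_m (-1)^(m+1) cos(2ms) / (4m^2 - 1).
    Evenness and pi-periodicity of both sides reduce it to [0, pi / 2]. *)
Lemma abs_cos_fourier (s : R) : abs_cos_series s = PI / 4 * Rabs (cos s).
Proof.
pose proof PI_RGT_0.
assert (Even : forall x, abs_cos_series (- x) = abs_cos_series x).
{ intro x; unfold abs_cos_series; f_equal; apply Series_ext; intro k.
  rewrite !Rplus_0_r, Ropp_mult_distr_r_reverse, cos_neg; reflexivity. }
assert (Half : forall x, - (PI / 2) <= x <= PI / 2 ->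
  abs_cos_series x = PI / 4 * Rabs (cos x)).
{ intros x Hx.
  rewrite (Rabs_pos_eq (cos x)) by (apply cos_ge_0; lra).
  destruct (Rle_dec 0 x); [apply abs_cos_series_quarter; lra|].
  rewrite <- Even, <- cos_neg; apply abs_cos_series_quarter; lra. }
assert (Pos : forall x, 0 <= x -> abs_cos_series x = PI / 4 * Rabs (cos x)).
{ intros x Hx.
  destruct (nfloor_ex ((x + PI / 2) / PI)) as [n [Hn1 Hn2]].
  { apply Rle_mult_inv_pos; lra. }
  apply Rmult_le_compat_r with (r := PI) in Hn1; [|lra].
  apply Rmult_lt_compat_r with (r := PI) in Hn2; [|lra].
  replace ((x + PI / 2) / PI * PI) with (x + PI / 2) in * by (field; lra).
  set (y := x - INR n * PI).
  replace x with (y + INR n * PI) by (unfold y; ring).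
  unfold abs_cos_series; rewrite trig_series_freq_periodic.
  rewrite cos_add_INR_PI, Rabs_mult, pow_1_abs, Rmult_1_l.
  apply Half; unfold y; lra. }
destruct (Rle_dec 0 s); [apply Pos; assumption|].
rewrite <- Even, <- cos_neg; apply Pos; lra.
Qed.

(** * The first-order profile v1 *)

Definition v1_coef (k : nat) : R := - sgn_gap k * / gap k.

Lemma Rabs_v1_coef (k : nat) : Rabs (v1_coef k) = / gap k * / gap k.
Proof.
unfold v1_coef; rewrite Rabs_mult, Rabs_Ropp, Rabs_sgn_gap.
f_equal; apply Rabs_pos_eq, Rlt_le, Rinv_0_lt_compat; pose proof (gap_ge k); lra.
Qed.

Lemma ex_series_v1_coef : ex_series (fun k => Rabs (v1_coef k)).
Proof.
apply (ex_series_gap_bound _ 1); intro k; rewrite Rabs_v1_coef.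
pose proof (gap_ge k) as [G _].
assert (0 < / gap k <= 1)
  by (split; [apply Rinv_0_lt_compat; lra |
      rewrite <- Rinv_1; apply Rinv_le_contravar; lra]).
nra.
Qed.

Lemma ex_series_v1_coef1 : ex_series (fun k => Rabs (v1_coef k * freq k)).
Proof.
apply (ex_series_gap_bound _ 1); intro k.
pose proof (gap_ge k) as [G [F _]]; pose proof (freq_ge_2 k).
rewrite Rabs_mult, Rabs_v1_coef, (Rabs_pos_eq (freq k)) by lra.
assert (0 < / gap k) by (apply Rinv_0_lt_compat; lra).
assert (/ gap k * gap k = 1) by (field; lra).
nra.
Qed.

Lemma ex_series_v1_coef2 : ex_series (fun k => Rabs (v1_coef k * freq k * freq k)).
Proof.
apply (ex_series_gap_bound _ 2); intro k.
pose proof (gap_ge k) as [G [_ F]]; pose proof (freq_ge_2 k).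
rewrite !Rabs_mult, Rabs_v1_coef, (Rabs_pos_eq (freq k)) by lra.
assert (0 < / gap k) by (apply Rinv_0_lt_compat; lra).
assert (/ gap k * gap k = 1) by (field; lra).
replace (/ gap k * / gap k * freq k * freq k)
  with (/ gap k * (/ gap k * freq k ^ 2)) by ring.
nra.
Qed.

Lemma v1_trig_series (omega0 a0 s : R) :
  v1 omega0 a0 s = - a0 / (PI * omega0 ^ 2) *
    (1 - cos s + 2 * (trig_series v1_coef freq 0 s
                      - trig_series v1_coef freq 0 0 * cos s)).
Proof.
unfold v1; do 3 f_equal.
pose proof ex_series_v1_coef as Hc.
unfold trig_series; rewrite <- Series_scal_r, <- Series_minus.
- apply Series_ext; intro k.
  rewrite Rmult_0_r, !Rplus_0_r, cos_0.
  unfold v1_term, v1_coef, sgn_gap, gap, freq; simpl pow.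
  pose proof (gap_ge k) as [G _]; unfold gap, freq in G; simpl pow in G.
  field; lra.
- apply ex_series_trig, Hc.
- apply ex_series_scal_r, ex_series_trig, Hc.
Qed.

(** Applying y'' + y multiplies the coefficient of the m-th harmonic by
    1 - 4 m^2, which cancels one of the two factors 1 / gap and leaves the Fourier
    series of |cos s|. *)
Lemma trig_series_v1_coef_oscillator (s : R) :
  trig_series (fun k => v1_coef k * freq k * freq k) freq (0 + PI / 2 + PI / 2) s
  + trig_series v1_coef freq 0 s = PI / 4 * Rabs (cos s) - / 2.
Proof.
rewrite <- abs_cos_fourier; unfold abs_cos_series.
ring_simplify; unfold trig_series.
rewrite <- Series_plus;
  [| apply ex_series_trig, ex_series_v1_coef2 | apply ex_series_trig, ex_series_v1_coef].
apply Series_ext; intro k.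
replace (freq k * s + (0 + PI / 2 + PI / 2)) with (freq k * s + 0 + PI) by field.
rewrite neg_cos; unfold v1_coef.
pose proof (gap_ge k) as [G _].
assert (E : freq k * freq k = gap k + 1) by (unfold gap; ring).
transitivity (sgn_gap k * / gap k * (freq k * freq k - 1) * cos (freq k * s + 0));
  [ring|].
rewrite E; field; lra.
Qed.

(** The constant term of v1 compensates the mean 1/2 in the expansion of |cos s|,
    and its cos s component is adjusted so that v1 and its derivative vanish
    at 0. *)
Lemma v1_forced_oscillator (omega0 a0 : R) : 0 < omega0 ->
  exists (dv1 : R -> R) (M : R), 0 <= M /\
  v1 omega0 a0 0 = 0 /\ dv1 0 = 0 /\
  (forall s (n : nat), v1 omega0 a0 (s + 2 * INR n * PI) = v1 omega0 a0 s) /\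
  forall s, is_derive (v1 omega0 a0) s (dv1 s) /\
    is_derive dv1 s (- v1 omega0 a0 s - a0 / (2 * omega0 ^ 2) * Rabs (cos s)) /\
    Rabs (v1 omega0 a0 s) <= M /\ Rabs (dv1 s) <= M.
Proof.
intro H0; pose proof PI_RGT_0 as HPI.
set (W := trig_series v1_coef freq 0).
set (W1 := trig_series (fun k => v1_coef k * freq k) freq (0 + PI / 2)).
set (W2 := trig_series (fun k => v1_coef k * freq k * freq k) freq
             (0 + PI / 2 + PI / 2)).
assert (D1 : forall s, is_derive W s (W1 s)) by
  (intro s; apply is_derive_trig_series;
   [apply ex_series_v1_coef | apply ex_series_v1_coef1]).
assert (D2 : forall s, is_derive W1 s (W2 s)) by
  (intro s; apply is_derive_trig_series;
   [apply ex_series_v1_coef1 | apply ex_series_v1_coef2]).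
assert (E2 : forall s, W2 s = - W s + PI / 4 * Rabs (cos s) - / 2).
{ intro s; pose proof (trig_series_v1_coef_oscillator s) as E.
  fold W2 W in E; lra. }
set (K := - a0 / (PI * omega0 ^ 2)).
assert (V : forall s, v1 omega0 a0 s = K * (1 - cos s + 2 * (W s - W 0 * cos s)))
  by (intro s; apply v1_trig_series).
set (S0 := Series (fun k => Rabs (v1_coef k))).
set (S1 := Series (fun k => Rabs (v1_coef k * freq k))).
assert (B0 : forall s, Rabs (W s) <= S0)
  by (intro s; apply trig_series_bound, ex_series_v1_coef).
assert (B1 : forall s, Rabs (W1 s) <= S1)
  by (intro s; apply trig_series_bound, ex_series_v1_coef1).
assert (P0 : 0 <= S0) by (eapply Rle_trans; [apply Rabs_pos | apply (B0 0)]).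
assert (P1 : 0 <= S1) by (eapply Rle_trans; [apply Rabs_pos | apply (B1 0)]).
exists (fun s => K * (sin s + 2 * (W1 s + W 0 * sin s))).
exists (Rabs K * (2 + 4 * S0 + 2 * S1)).
split; [apply Rmult_le_pos; [apply Rabs_pos | lra]|].
split; [rewrite V, cos_0; ring|].
split.
{ rewrite sin_0.
  replace (W1 0) with 0; [ring|].
  symmetry; unfold W1, trig_series; rewrite (Series_ext _ (fun _ => 0 * 0)).
  - rewrite Series_scal_l; ring.
  - intro k; rewrite Rmult_0_r, !Rplus_0_l, cos_PI2; ring. }
split.
{ intros s n; rewrite !V, cos_period.
  replace (W (s + 2 * INR n * PI)) with (W s); [reflexivity|].
  replace (2 * INR n * PI) with (INR (2 * n) * PI)
    by (rewrite mult_INR; simpl; ring).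
  symmetry; apply trig_series_freq_periodic. }
intro s; split; [|split; [|split]].
- apply (is_derive_ext (fun s => K * (1 - cos s + 2 * (W s - W 0 * cos s)))).
  { intro t; rewrite V; reflexivity. }
  auto_derive; [exists (W1 s); apply D1|].
  rewrite (is_derive_unique (fun x : R => W x) _ _ (D1 s)); ring.
- auto_derive; [exists (W2 s); apply D2|].
  rewrite (is_derive_unique (fun x : R => W1 x) _ _ (D2 s)), E2, V.
  unfold K; field; lra.
- rewrite V, Rabs_mult; apply Rmult_le_compat_l; [apply Rabs_pos|].
  pose proof (B0 s) as A1; pose proof (B0 0) as A2.
  apply Rabs_le_between in A1; apply Rabs_le_between in A2.
  pose proof (COS_bound s); apply Rabs_le; split; nra.
- rewrite Rabs_mult; apply Rmult_le_compat_l; [apply Rabs_pos|].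
  pose proof (B1 s) as A1; pose proof (B0 0) as A2.
  apply Rabs_le_between in A1; apply Rabs_le_between in A2.
  pose proof (SIN_bound s); apply Rabs_le; split; nra.
Qed.

(** * Perturbed harmonic oscillators *)

Lemma pos_part_abs (x : R) : pos_part x = (x + Rabs x) / 2.
Proof.
unfold pos_part, Rmax, Rabs; destruct (Rle_dec 0 x), (Rcase_abs x); lra.
Qed.

Lemma pos_part_lipschitz (x y : R) :
  Rabs (pos_part x - pos_part y) <= Rabs (x - y).
Proof.
rewrite !pos_part_abs.
unfold Rabs; destruct (Rcase_abs x), (Rcase_abs y), (Rcase_abs (x - y));
  destruct Rcase_abs; lra.
Qed.

(** The energy E = d1^2 + w^2 d^2 satisfies E' = 2 d1 (d2 + w^2 d). Young's
    inequality bounds this by (1 + e / w) E + m^2, because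
    2 e |d| |d1| <= (e / w) E and 2 m |d1| <= d1^2 + m^2; hence
    (E + m^2) exp(- (1 + e / w) t) is nonincreasing. *)
Lemma gronwall_oscillator (w e m a b : R) (d d1 d2 : R -> R) :
  0 < w -> 0 <= e -> 0 <= m -> a <= b ->
  (forall t, a <= t <= b -> is_derive d t (d1 t) /\ is_derive d1 t (d2 t) /\
    Rabs (d2 t + w ^ 2 * d t) <= e * Rabs (d t) + m) ->
  d a = 0 -> d1 a = 0 ->
  d1 b ^ 2 + w ^ 2 * d b ^ 2 <= m ^ 2 * exp ((1 + e / w) * (b - a)).
Proof.
intros Hw He Hm Hab H Ha Ha1.
set (c := 1 + e / w).
assert (Hc : e = (c - 1) * w) by (unfold c; field; lra).
assert (Hc1 : 0 <= c - 1)
  by (unfold c; ring_simplify; apply Rle_mult_inv_pos; assumption).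
clearbody c.
set (F := fun t => (d1 t ^ 2 + w ^ 2 * d t ^ 2 + m ^ 2) * exp (- c * (t - a))).
set (dF := fun t => (2 * d1 t * (d2 t + w ^ 2 * d t)
   - c * (d1 t ^ 2 + w ^ 2 * d t ^ 2 + m ^ 2)) * exp (- c * (t - a))).
assert (HF : forall t, a <= t <= b -> is_derive F t (dF t)).
{ intros t Ht; destruct (H t Ht) as [D [D1 _]]; unfold F, dF.
  auto_derive;
    [split; [exists (d2 t); exact D1 | split; [exists (d1 t); exact D | trivial]]|].
  rewrite (is_derive_unique (fun x : R => d x) _ _ D).
  rewrite (is_derive_unique (fun x : R => d1 x) _ _ D1).
  change (t + - a) with (t - a); ring. }
assert (HdF : forall t, a <= t <= b -> dF t <= 0).
{ intros t Ht; destruct (H t Ht) as [_ [_ B]]; unfold dF.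
  assert (2 * d1 t * (d2 t + w ^ 2 * d t)
    <= c * (d1 t ^ 2 + w ^ 2 * d t ^ 2 + m ^ 2)).
  { set (x := d1 t) in *; set (y := d t) in *; set (z := d2 t + w ^ 2 * y) in *.
    apply Rle_trans with (2 * Rabs x * (e * Rabs y + m)).
    - pose proof (Rle_abs (x * z)) as A; rewrite Rabs_mult in A.
      pose proof (Rabs_pos x); nra.
    - rewrite <- (pow2_abs x), <- (pow2_abs y), Hc.
      pose proof (Rabs_pos x); pose proof (Rabs_pos y).
      set (X := Rabs x) in *; set (Y := Rabs y) in *.
      pose proof (pow2_ge_0 (X - w * Y)); pose proof (pow2_ge_0 (X - m)).
      assert (0 <= (c - 1) * (X - w * Y) ^ 2) by (apply Rmult_le_pos; lra).
      assert (0 <= (c - 1) * m ^ 2) by (apply Rmult_le_pos; [lra | apply pow2_ge_0]).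
      pose proof (pow2_ge_0 (w * Y)).
      nra. }
  pose proof (exp_pos (- c * (t - a))); nra. }
destruct (MVT_gen F a b dF) as [t [Ht E]].
- rewrite Rmin_left, Rmax_right by lra; intros t Ht; apply HF; lra.
- rewrite Rmin_left, Rmax_right by lra; intros t Ht.
  apply derivable_continuous_pt; exists (dF t); apply is_derive_Reals, HF, Ht.
- rewrite Rmin_left, Rmax_right in Ht by lra.
  specialize (HdF t Ht).
  assert (L : F b <= F a) by nra.
  unfold F in L; rewrite Ha, Ha1, Rminus_diag, Rmult_0_r, exp_0 in L.
  assert (P : exp (- c * (b - a)) * exp (c * (b - a)) = 1)
    by (rewrite <- exp_plus, <- exp_0; f_equal; ring).
  pose proof (exp_pos (c * (b - a))) as Q.
  apply Rmult_le_compat_r with (r := exp (c * (b - a))) in L; [|lra].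
  rewrite Rmult_assoc, P in L.
  pose proof (pow2_ge_0 m); nra.
Qed.

Definition solves_on (w e a b : R) (u u1 : R -> R) : Prop :=
  forall t, a <= t <= b ->
    is_derive u t (u1 t) /\ is_derive u1 t (- (w ^ 2 * u t + e * pos_part (u t))).

Lemma solves_on_unique (w e a b : R) (u u1 v v1 : R -> R) :
  0 < w -> 0 <= e -> a <= b ->
  solves_on w e a b u u1 -> solves_on w e a b v v1 ->
  u a = v a -> u1 a = v1 a -> u b = v b /\ u1 b = v1 b.
Proof.
intros Hw He Hab Hu Hv E E1.
assert (Q : (u1 b - v1 b) ^ 2 + w ^ 2 * (u b - v b) ^ 2 <= 0).
{ eapply Rle_trans; [apply (gronwall_oscillator w e 0 a b
    (fun t => u t - v t) (fun t => u1 t - v1 t)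
    (fun t => - (w ^ 2 * u t + e * pos_part (u t))
              - - (w ^ 2 * v t + e * pos_part (v t)))); try lra
  | apply Req_le; ring].
  intros t Ht; destruct (Hu t Ht) as [U U1], (Hv t Ht) as [V V1].
  split; [apply (is_derive_minus (K := R_AbsRing) (V := R_NormedModule)); assumption|].
  split; [apply (is_derive_minus (K := R_AbsRing) (V := R_NormedModule)); assumption|].
  match goal with |- Rabs ?x <= _ =>
    replace x with (- (e * (pos_part (u t) - pos_part (v t)))) by ring end.
  rewrite Rabs_Ropp, Rabs_mult, (Rabs_pos_eq e), Rplus_0_r by lra.
  apply Rmult_le_compat_l; [lra | apply pos_part_lipschitz]. }
assert (0 < w ^ 2) by (apply pow_lt; lra).
pose proof (pow2_ge_0 (u b - v b)); pose proof (pow2_ge_0 (u1 b - v1 b)).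
split; apply Rminus_diag_uniq, Rsqr_0_uniq; rewrite Rsqr_pow2; nra.
Qed.

(** The equation is autonomous and reversible: a solution at rest at time c agrees
    with its mirror image about c. *)
Lemma solution_reflection (w e c : R) (u u1 : R -> R) :
  0 < w -> 0 <= e -> (forall a b, solves_on w e a b u u1) -> u1 c = 0 ->
  forall t, c <= t -> u (2 * c - t) = u t.
Proof.
intros Hw He Hu Hc t Ht.
apply (solves_on_unique w e c t (fun t => u (2 * c - t)) (fun t => - u1 (2 * c - t)) u u1);
  auto; [| f_equal; ring | replace (2 * c - c) with c by ring; lra].
intros s _; destruct (Hu (2 * c - s) (2 * c - s) (2 * c - s)) as [U U1]; [lra|].
split.
- auto_derive; [exists (u1 (2 * c - s)); exact U|].
  change (2 * c + - s) with (2 * c - s).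
  rewrite (is_derive_unique (fun x : R => u x) _ _ U); ring.
- auto_derive; [eexists; exact U1|].
  change (2 * c + - s) with (2 * c - s).
  rewrite (is_derive_unique (fun x : R => u1 x) _ _ U1); ring.
Qed.

(** From the rest point at 0 the solution is a cosine of frequency
    mu = sqrt(w^2 + e) until it vanishes, after a quarter of period pi / (2 mu),
    then a negative sine of frequency w until it is at rest again, after
    pi / (2 w). The composition of the reflections about these two rest points is
    the translation by twice their distance. *)
Lemma solution_periodic (w e a0 : R) (u u1 : R -> R) :
  0 < w -> 0 <= e -> 0 <= a0 -> (forall a b, solves_on w e a b u u1) ->
  u 0 = a0 -> u1 0 = 0 ->
  forall t, 0 <= t -> u (t + (PI / w + PI / sqrt (w ^ 2 + e))) = u t.
Proof.
intros Hw He Ha Hu H0 H1.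
pose proof PI_RGT_0 as HPI.
set (mu := sqrt (w ^ 2 + e)).
assert (Hw2 : 0 < w ^ 2) by (apply pow_lt; lra).
assert (Hmu : 0 < mu) by (apply sqrt_lt_R0; lra).
assert (Hmu2 : mu * mu = w ^ 2 + e) by (apply sqrt_def; lra).
set (h := PI / (2 * mu)).
assert (Hh : 0 < h) by (apply Rdiv_lt_0_compat; lra).
assert (Emu : mu * h = PI / 2) by (unfold h; field; lra).
set (k := PI / (2 * w)).
assert (Hk : 0 < k) by (apply Rdiv_lt_0_compat; lra).
assert (Ek : w * k = PI / 2) by (unfold k; field; lra).
destruct (solves_on_unique w e 0 h u u1 (fun t => a0 * cos (mu * t))
  (fun t => - a0 * mu * sin (mu * t))) as [A A1]; auto; try lra.
{ intros t Ht; split; [auto_derive; [trivial | ring]|].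
  auto_derive; [trivial|].
  rewrite pos_part_abs, Rabs_pos_eq.
  - transitivity (- (mu * mu) * a0 * cos (mu * t)); [ring | rewrite Hmu2; field].
  - apply Rmult_le_pos; [lra|]; apply cos_ge_0; nra. }
{ rewrite Rmult_0_r, cos_0; lra. }
{ rewrite Rmult_0_r, sin_0; lra. }
rewrite Emu, cos_PI2 in A; rewrite Emu, sin_PI2 in A1.
destruct (solves_on_unique w e h (h + k) u u1
  (fun t => - (a0 * mu / w) * sin (w * (t - h)))
  (fun t => - a0 * mu * cos (w * (t - h)))) as [_ B1]; auto; try lra.
{ intros t Ht; split; auto_derive; trivial; change (t + - h) with (t - h);
    [field; lra|].
  assert (0 <= (a0 * mu / w) * sin (w * (t - h))).
  { apply Rmult_le_pos; [apply Rle_mult_inv_pos; nra|].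
    apply sin_ge_0; nra. }
  rewrite pos_part_abs, Rabs_left1 by lra; field; lra. }
{ rewrite Rminus_diag, Rmult_0_r, sin_0; lra. }
{ rewrite Rminus_diag, Rmult_0_r, cos_0; lra. }
replace (w * (h + k - h)) with (PI / 2) in B1 by (rewrite <- Ek; ring).
rewrite cos_PI2, Rmult_0_r in B1.
intros t Ht.
rewrite <- (solution_reflection w e 0 u u1 Hw He Hu H1 t Ht).
replace (t + (PI / w + PI / mu)) with (2 * (h + k) + t)
  by (unfold h, k; field; lra).
rewrite <- (solution_reflection w e (h + k) u u1 Hw He Hu B1) by lra.
f_equal; ring.
Qed.

Lemma periodic_add_INR (f : R -> R) (P : R) : 0 <= P ->
  (forall t, 0 <= t -> f (t + P) = f t) ->
  forall n t, 0 <= t -> f (t + INR n * P) = f t.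
Proof.
intros HP H n; induction n as [|n IH]; intros t Ht.
- simpl; f_equal; ring.
- rewrite S_INR; replace (t + (INR n + 1) * P) with (t + INR n * P + P) by ring.
  rewrite H, IH; auto.
  pose proof (pos_INR n); nra.
Qed.

Lemma MVT_bound (f df : R -> R) (L : R) :
  (forall t, is_derive f t (df t)) -> (forall t, Rabs (df t) <= L) ->
  forall x y, Rabs (f x - f y) <= L * Rabs (x - y).
Proof.
intros D B x y.
destruct (MVT_gen f y x df) as [c [_ E]].
- intros; apply D.
- intros t _; apply derivable_continuous_pt; exists (df t); apply is_derive_Reals, D.
- rewrite E, Rabs_mult; apply Rmult_le_compat_r; [apply Rabs_pos | apply B].
Qed.

(** Some c in [t, t + 1] has f1 c = f (t + 1) - f t, and f1 varies by at most D
    between t and c. *)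
Lemma landau_derivative_bound (f f1 f2 : R -> R) (t B D : R) :
  (forall s, is_derive f s (f1 s)) -> (forall s, is_derive f1 s (f2 s)) ->
  (forall s, t <= s <= t + 1 -> Rabs (f s) <= B /\ Rabs (f2 s) <= D) ->
  Rabs (f1 t) <= 2 * B + D.
Proof.
intros H1 H2 Hb.
destruct (MVT_gen f t (t + 1) f1) as [c [Hc E]].
- intros; apply H1.
- intros s _; apply derivable_continuous_pt; exists (f1 s); apply is_derive_Reals, H1.
- rewrite Rmin_left, Rmax_right in Hc by lra.
  destruct (MVT_gen f1 t c f2) as [c' [Hc' E']].
  + intros; apply H2.
  + intros s _; apply derivable_continuous_pt; exists (f2 s); apply is_derive_Reals, H2.
  + rewrite Rmin_left, Rmax_right in Hc' by lra.
    destruct (Hb t ltac:(lra)) as [Bt _].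
    destruct (Hb (t + 1) ltac:(lra)) as [Bt1 _].
    destruct (Hb c' ltac:(lra)) as [_ Dc].
    apply Rabs_le_between in Bt, Bt1, Dc.
    apply Rabs_le; split; nra.
Qed.

(** * The approximation over long times *)

Lemma C2_norm_le (T B : R) (r r1 r2 : R -> R) :
  (forall t, is_derive r t (r1 t)) -> (forall t, is_derive r1 t (r2 t)) ->
  (forall t, continuous r2 t) ->
  (forall t, 0 <= t <= T -> Rabs (r t) <= B /\ Rabs (r1 t) <= B /\ Rabs (r2 t) <= B) ->
  C2_on 0 T r /\ Rbar_le (C2_norm 0 T r) (Finite B).
Proof.
intros H1 H2 Hc Hb.
assert (E1 : forall t, Derive r t = r1 t) by (intro; apply is_derive_unique, H1).
assert (E2 : forall t, Derive (Derive r) t = r2 t).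
{ intro t; rewrite (Derive_ext _ _ _ E1); apply is_derive_unique, H2. }
split.
- intros k t Hk _.
  destruct k as [|[|[|k]]]; simpl; [split | split | split | lia]; trivial.
  + apply (ex_derive_continuous (K := R_AbsRing) (V := R_NormedModule) r t).
    exists (r1 t); apply H1.
  + exists (r1 t); apply H1.
  + apply (continuous_ext r1); [intro; rewrite E1; reflexivity|].
    apply (ex_derive_continuous (K := R_AbsRing) (V := R_NormedModule) r1 t).
    exists (r2 t); apply H2.
  + apply (ex_derive_ext r1); [intro; rewrite E1; reflexivity|].
    exists (r2 t); apply H2.
  + apply (continuous_ext r2); [intro; rewrite E2; reflexivity | apply Hc].
- unfold C2_norm.
  apply (proj2 (Lub_Rbar_correct _)).
  intros y (k & t & Hk & Ht & ->); simpl.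
  destruct (Hb t Ht) as (B0 & B1 & B2).
  destruct k as [|[|[|k]]]; simpl; [| rewrite E1 | rewrite E2 | lia]; assumption.
Qed.

Lemma omega_sqr_expansion (w : R) : 0 < w -> exists K, 0 <= K /\
  forall e, 0 < e < 1 ->
    Rabs (omega w e ^ 2 - w ^ 2 - e / 2) <= K * e ^ 2.
Proof.
intro Hw; set (l := / w).
assert (Hl : 0 < l) by (apply Rinv_0_lt_compat, Hw).
assert (Hl3 : 0 < l ^ 3) by (apply pow_lt, Hl).
exists (l ^ 2 / 4 + (l / 4 + l ^ 3 / 8) ^ 2).
split; [pose proof (pow2_ge_0 l); pose proof (pow2_ge_0 (l / 4 + l ^ 3 / 8)); lra|].
intros e He.
replace (omega w e ^ 2 - w ^ 2 - e / 2)
  with ((- (l ^ 2 / 4) + (l / 4 - e * l ^ 3 / 8) ^ 2) * e ^ 2)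
  by (unfold omega, l; field; lra).
rewrite Rabs_mult, (Rabs_pos_eq (e ^ 2)) by apply pow2_ge_0.
apply Rmult_le_compat_r; [apply pow2_ge_0|].
pose proof (pow2_ge_0 l).
pose proof (pow2_ge_0 (l / 4 - e * l ^ 3 / 8)).
assert (0 <= e * l ^ 3 / 8 <= l ^ 3 / 8) by nra.
assert ((l / 4 - e * l ^ 3 / 8) ^ 2 <= (l / 4 + l ^ 3 / 8) ^ 2)
  by (apply pow_maj_Rabs, Rabs_le; lra).
apply Rabs_le; lra.
Qed.

(** With p = sqrt(1 + e / w^2) - 1, everything is rational in p and the defect is
    exactly - pi p^3 (10 + 6 p + p^2) / (8 (1 + p)), where p <= e / w^2. *)
Lemma omega_period_expansion (w : R) : 0 < w -> exists K, 0 <= K /\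
  forall e, 0 < e < 1 ->
    Rabs (omega w e * (PI / w + PI / sqrt (w ^ 2 + e)) - 2 * PI) <= K * e ^ 3.
Proof.
intro Hw; pose proof PI_RGT_0 as HPI.
assert (Hw2 : 0 < w ^ 2) by (apply pow_lt, Hw).
set (L := / w ^ 2); assert (HL : 0 < L) by (apply Rinv_0_lt_compat, Hw2).
exists (PI / 8 * (L ^ 3 * (10 + 6 * L + L ^ 2))).
assert (HL3 : 0 < L ^ 3) by (apply pow_lt, HL).
assert (HL2 : 0 < L ^ 2) by (apply pow_lt, HL).
split; [apply Rmult_le_pos; [lra|]; apply Rmult_le_pos; lra|].
intros e He.
set (mu := sqrt (w ^ 2 + e)).
assert (Hmu2 : mu * mu = w ^ 2 + e) by (apply sqrt_def; lra).
assert (Hmu : 0 < mu) by (apply sqrt_lt_R0; lra).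
assert (Hmw : w < mu) by nra.
set (p := mu / w - 1).
assert (Ep : mu = w * (1 + p)) by (unfold p; field; lra).
assert (Hp : 0 < p).
{ unfold p; apply (Rmult_lt_reg_r w); [exact Hw|]; field_simplify; lra. }
assert (Ee : e = w ^ 2 * (p * (2 + p))) by (rewrite Ep in Hmu2; nra).
assert (HpL : p <= L * e).
{ replace (L * e) with (p * (2 + p)) by (rewrite Ee; unfold L; field; lra); nra. }
replace (omega w e * (PI / w + PI / mu) - 2 * PI)
  with (- (PI / 8 * (p ^ 3 * (10 + 6 * p + p ^ 2)) / (1 + p)))
  by (rewrite Ep; unfold omega; rewrite Ee; field; lra).
assert (Hp2 : 0 < p ^ 2) by (apply pow_lt, Hp).
assert (Hp3 : 0 < p ^ 3) by (apply pow_lt, Hp).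
assert (HN : 0 < PI / 8 * (p ^ 3 * (10 + 6 * p + p ^ 2)))
  by (apply Rmult_lt_0_compat; [lra|]; apply Rmult_lt_0_compat; lra).
rewrite Rabs_Ropp, Rabs_pos_eq by (apply Rlt_le, Rdiv_lt_0_compat; lra).
apply Rle_trans with (PI / 8 * (p ^ 3 * (10 + 6 * p + p ^ 2))).
{ apply (Rmult_le_reg_r (1 + p)); [lra|].
  unfold Rdiv at 1; rewrite Rmult_assoc, Rinv_l, Rmult_1_r by lra; nra. }
replace (PI / 8 * (L ^ 3 * (10 + 6 * L + L ^ 2)) * e ^ 3)
  with (PI / 8 * ((L * e) ^ 3 * (10 + 6 * L + L ^ 2))) by ring.
apply Rmult_le_compat_l; [lra|].
assert (HpL' : p <= L) by nra.
apply Rmult_le_compat; try nra.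
apply pow_incr; lra.
Qed.

(** In this expression c stands for cos s and v for v1(s), and omega^2 multiplies
    the second derivative of the profile a0 cos + e v1, with v1'' replaced by its
    value from the forced oscillator. Since
    omega^2 = w^2 + e / 2 + O(e^2), the terms of order e are
    a0 c_+ - a0 c / 2 - a0 |c| / 2, which vanish because c_+ = (c + |c|) / 2; in
    the term e (a0 c + e v)_+ the kink costs only e^2 |v|, by the Lipschitz
    bound. *)
Lemma residual_bound (w a0 M : R) : 0 < w -> 0 < a0 -> 0 <= M ->
  exists K, 0 <= K /\
  forall e c v, 0 < e < 1 -> Rabs c <= 1 -> Rabs v <= M ->
    Rabs (omega w e ^ 2 * (a0 * - c + e * (- v - a0 / (2 * w ^ 2) * Rabs c))
          + w ^ 2 * (a0 * c + e * v) + e * pos_part (a0 * c + e * v))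
    <= K * e ^ 2.
Proof.
intros Hw Ha HM.
destruct (omega_sqr_expansion w Hw) as [K1 [HK1 HO]].
set (A := a0 / (2 * w ^ 2)).
assert (Hw2 : 0 < w ^ 2) by (apply pow_lt, Hw).
assert (HA : 0 < A) by (apply Rdiv_lt_0_compat; lra).
exists (K1 * (a0 + M) + M / 2 + (K1 + / 2) * A + M).
split; [assert (0 <= K1 * (a0 + M)) by nra; assert (0 <= (K1 + / 2) * A) by nra; lra|].
intros e c v He Hc Hv; specialize (HO e He).
set (delta := omega w e ^ 2 - w ^ 2 - e / 2) in *.
set (q := pos_part (a0 * c + e * v) - pos_part (a0 * c)).
assert (Hq : Rabs q <= e * M).
{ eapply Rle_trans; [apply pos_part_lipschitz|].
  replace (a0 * c + e * v - a0 * c) with (e * v) by ring.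
  rewrite Rabs_mult, (Rabs_pos_eq e) by lra; apply Rmult_le_compat_l; lra. }
match goal with |- Rabs ?x <= _ => replace x with
  (- (delta * (a0 * c + e * v)) + - (e * (e / 2) * v)
   + - (e * (delta + e / 2) * (A * Rabs c)) + e * q) end.
2:{ assert (EA : w ^ 2 * A = a0 / 2) by (unfold A; field; lra).
    assert (Eq : pos_part (a0 * c + e * v) = q + a0 * (c + Rabs c) / 2).
    { unfold q; rewrite (pos_part_abs (a0 * c)), Rabs_mult, (Rabs_pos_eq a0) by lra.
      lra. }
    assert (Eo : omega w e ^ 2 = delta + w ^ 2 + e / 2) by (unfold delta; ring).
    rewrite Eq, Eo.
    transitivity (- (delta * (a0 * c + e * v)) + - (e * (e / 2) * v)
      + - (e * (delta + e / 2) * (A * Rabs c)) + e * q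
      + e * Rabs c * (a0 / 2 - w ^ 2 * A)); [rewrite EA; ring | field]. }
assert (He2 : 0 < e ^ 2 < e) by (split; nra).
pose proof (Rabs_pos c) as Hc0; pose proof (Rabs_pos delta) as Hd0.
assert (T1 : Rabs (delta * (a0 * c + e * v)) <= K1 * e ^ 2 * (a0 + M)).
{ rewrite Rabs_mult; apply Rmult_le_compat; auto using Rabs_pos.
  eapply Rle_trans; [apply Rabs_triang|].
  rewrite !Rabs_mult, (Rabs_pos_eq a0), (Rabs_pos_eq e) by lra.
  pose proof (Rabs_pos v); nra. }
assert (T2 : Rabs (e * (e / 2) * v) <= e ^ 2 * (M / 2)).
{ rewrite Rabs_mult, (Rabs_pos_eq (e * (e / 2))) by nra; nra. }
assert (T3 : Rabs (e * (delta + e / 2) * (A * Rabs c)) <= e ^ 2 * ((K1 + / 2) * A)).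
{ rewrite !Rabs_mult, Rabs_Rabsolu, (Rabs_pos_eq A), (Rabs_pos_eq e) by lra.
  assert (Rabs (delta + e / 2) <= (K1 + / 2) * e).
  { eapply Rle_trans; [apply Rabs_triang|].
    rewrite (Rabs_pos_eq (e / 2)) by lra; nra. }
  replace (e ^ 2 * ((K1 + / 2) * A)) with (e * ((K1 + / 2) * e) * (A * 1)) by ring.
  apply Rmult_le_compat; try nra.
  apply Rmult_le_pos; [lra | apply Rabs_pos]. }
assert (T4 : Rabs (e * q) <= e ^ 2 * M).
{ rewrite Rabs_mult, (Rabs_pos_eq e) by lra; nra. }
eapply Rle_trans; [apply Rabs_triang|].
eapply Rle_trans; [apply Rplus_le_compat_r, Rabs_triang|].
eapply Rle_trans; [apply Rplus_le_compat_r, Rplus_le_compat_r, Rabs_triang|].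
rewrite !Rabs_Ropp; lra.
Qed.

Theorem proposition1 (omega0 a0 : R) (Homega0 : 0 < omega0) (Ha0 : 0 < a0)
  (u : R -> R -> R)
  (Hu : forall eps : R, 0 < eps -> is_solution omega0 a0 eps (u eps)) :
  exists gamma : R, 0 < gamma /\
    O_eps2_in_C2 (fun eps : R => gamma / eps)
      (fun eps t : R =>
         u eps t - (a0 * cos (omega omega0 eps * t)
                    + eps * v1 omega0 a0 (omega omega0 eps * t))).
Proof.
pose proof PI_RGT_0 as HPI.
assert (HPI1 : 1 <= PI) by (pose proof PI2_1; lra).
destruct (v1_forced_oscillator omega0 a0 Homega0) as
  (dv1 & M & HM & Hv0 & Hdv0 & Hvper & Hv).
destruct (residual_bound omega0 a0 M Homega0 Ha0 HM) as [K [HK Hres]].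
destruct (omega_period_expansion omega0 Homega0) as [K2 [HK2 Hper]].
set (G := exp ((1 + / omega0) * (PI / omega0)) / omega0).
assert (HG : 0 < G) by (apply Rdiv_lt_0_compat; [apply exp_pos | assumption]).
set (C0 := K * G + (a0 + M) * (2 * omega0 * K2)).
assert (HC0 : 0 <= C0).
{ assert (0 <= K * G) by nra; assert (0 <= 2 * omega0 * K2) by nra.
  unfold C0; nra. }
set (C2 := (omega0 ^ 2 + 1) * C0 + K).
assert (Hw2 : 0 < omega0 ^ 2) by (apply pow_lt; assumption).
assert (HC2 : C0 <= C2) by (unfold C2; nra).
exists 1; split; [lra|].
exists (2 * C0 + C2), 1; split; [lra|].
intros eps Heps.
destruct (Hu eps) as (Hu1 & Hu2 & Hode & Hu0 & Hdu0); [lra|].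
set (om := omega omega0 eps).
set (U := u eps) in *.
set (V := fun s => a0 * cos s + eps * v1 omega0 a0 s).
set (V1 := fun s => a0 * - sin s + eps * dv1 s).
set (V2 := fun s => a0 * - cos s
  + eps * (- v1 omega0 a0 s - a0 / (2 * omega0 ^ 2) * Rabs (cos s))).
set (r := fun t => U t - V (om * t)).
set (r1 := fun t => Derive U t - om * V1 (om * t)).
set (r2 := fun t => - (omega0 ^ 2 * U t + eps * pos_part (U t))
                    - om ^ 2 * V2 (om * t)).
assert (Hsol : forall a b, solves_on omega0 eps a b U (Derive U)).
{ intros a b t _; split; [apply Derive_correct, Hu1|].
  replace (- _) with (Derive (Derive U) t) by (specialize (Hode t); lra).
  apply Derive_correct, Hu2. }
assert (HV : forall s, is_derive V s (V1 s)).
{ intro s; destruct (Hv s) as [D _]; unfold V, V1.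
  auto_derive; [eexists; exact D|].
  rewrite (is_derive_unique (fun x : R => v1 omega0 a0 x) _ _ D); ring. }
assert (HV1 : forall s, is_derive V1 s (V2 s)).
{ intro s; destruct (Hv s) as [_ [D _]]; unfold V1, V2.
  auto_derive; [eexists; exact D|].
  rewrite (is_derive_unique (fun x : R => dv1 x) _ _ D); ring. }
assert (Hr : forall t, is_derive r t (r1 t)).
{ intro t; unfold r, r1; auto_derive.
  - split; [apply Hu1 | split; [eexists; apply HV | trivial]].
  - rewrite (is_derive_unique (fun x : R => V x) _ _ (HV (om * t))).
    change (Derive (fun x : R => U x) t) with (Derive U t); ring. }
assert (Hr1 : forall t, is_derive r1 t (r2 t)).
{ intro t; unfold r1, r2; destruct (Hsol t t t) as [_ D]; [lra|].
  auto_derive.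
  - split; [apply Hu2 | split; [eexists; apply HV1 | trivial]].
  - rewrite (is_derive_unique (fun x : R => V1 x) _ _ (HV1 (om * t))).
    rewrite (is_derive_unique (fun x : R => Derive U x) _ _ D); ring. }
(* The hypothesis of the Gronwall estimate, and later the bound on r2. *)
assert (Hode_r : forall t,
  Rabs (r2 t + omega0 ^ 2 * r t) <= eps * Rabs (r t) + K * eps ^ 2).
{ intro t; destruct (Hv (om * t)) as (_ & _ & Bv & _).
  assert (Bc : Rabs (cos (om * t)) <= 1) by apply Rabs_le, COS_bound.
  pose proof (Hres eps _ _ Heps Bc Bv) as B.
  set (Res := omega omega0 eps ^ 2 * _ + _ + _) in B.
  replace (r2 t + omega0 ^ 2 * r t)
    with (- (eps * (pos_part (U t) - pos_part (V (om * t)))) + - Res)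
    by (unfold r2, r, Res, V, V2, om; ring).
  eapply Rle_trans; [apply Rabs_triang|].
  rewrite !Rabs_Ropp, Rabs_mult, (Rabs_pos_eq eps) by lra.
  apply Rplus_le_compat; [|exact B].
  apply Rmult_le_compat_l; [lra | apply pos_part_lipschitz]. }
set (P := PI / omega0 + PI / sqrt (omega0 ^ 2 + eps)).
assert (Hmu : omega0 < sqrt (omega0 ^ 2 + eps)).
{ rewrite <- (sqrt_pow2 omega0) at 1 by lra; apply sqrt_lt_1; lra. }
assert (HP : / omega0 <= P <= 2 * (PI / omega0)).
{ assert (0 < / sqrt (omega0 ^ 2 + eps) <= / omega0)
    by (split; [apply Rinv_0_lt_compat | apply Rinv_le_contravar]; lra).
  unfold P, Rdiv; split; nra. }
assert (Hw : 0 < / omega0) by (apply Rinv_0_lt_compat; assumption).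
(* G comes from a period at most 2 pi / omega0 and from eps <= 1. *)
assert (Hone : forall t, 0 <= t <= P -> Rabs (r t) <= K * G * eps ^ 2).
{ intros t Ht.
  assert (E : r1 t ^ 2 + omega0 ^ 2 * r t ^ 2 <=
    (K * eps ^ 2) ^ 2 * exp ((1 + eps / omega0) * (t - 0))).
  { apply (gronwall_oscillator omega0 eps _ 0 t r r1 r2); try lra.
    - apply Rmult_le_pos; [assumption | apply pow2_ge_0].
    - intros s _; auto.
    - unfold r, V; rewrite Rmult_0_r, cos_0, Hv0, Hu0; ring.
    - unfold r1, V1; rewrite Rmult_0_r, sin_0, Hdv0, Hdu0; ring. }
  assert (X : exp ((1 + eps / omega0) * (t - 0)) <= (omega0 * G) ^ 2).
  { replace ((omega0 * G) ^ 2) with (exp ((1 + / omega0) * (2 * (PI / omega0)))).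
    - assert (L : (1 + eps / omega0) * (t - 0) <= (1 + / omega0) * (2 * (PI / omega0))).
      { unfold Rdiv at 1; apply Rmult_le_compat; nra. }
      destruct L as [L | ->]; [apply Rlt_le, exp_increasing, L | apply Rle_refl].
    - unfold G; replace ((1 + / omega0) * (2 * (PI / omega0)))
        with ((1 + / omega0) * (PI / omega0) + (1 + / omega0) * (PI / omega0)) by ring.
      rewrite exp_plus; field; lra. }
  assert (Y : (omega0 * r t) ^ 2 <= (omega0 * (K * G * eps ^ 2)) ^ 2).
  { pose proof (pow2_ge_0 (r1 t)); pose proof (pow2_ge_0 (K * eps ^ 2)).
    apply Rle_trans with ((K * eps ^ 2) ^ 2 * (omega0 * G) ^ 2); nra. }
  pose proof (pow2_ge_0 eps).
  assert (Z : Rabs (omega0 * r t) <= Rabs (omega0 * (K * G * eps ^ 2)))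
    by (apply Rsqr_le_abs_0; rewrite !Rsqr_pow2; exact Y).
  rewrite !(Rabs_mult omega0), (Rabs_pos_eq omega0) in Z by lra.
  rewrite (Rabs_pos_eq (K * G * eps ^ 2)) in Z by
    (apply Rmult_le_pos; [apply Rmult_le_pos|]; lra).
  apply Rmult_le_reg_l in Z; assumption. }
assert (Hall : forall t, 0 <= t <= 2 / eps -> Rabs (r t) <= C0 * eps ^ 2).
{ intros t Ht.
  destruct (nfloor_ex (t / P)) as [n [Hn1 Hn2]]; [apply Rle_mult_inv_pos; lra|].
  apply Rmult_le_compat_r with (r := P) in Hn1; [|lra].
  apply Rmult_lt_compat_r with (r := P) in Hn2; [|lra].
  replace (t / P * P) with t in * by (field; lra).
  set (tau := t - INR n * P).
  assert (Et : t = tau + INR n * P) by (unfold tau; ring).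
  assert (Htau : 0 <= tau <= P) by (unfold tau; lra).
  assert (EU : U t = U tau).
  { rewrite Et; apply periodic_add_INR; [lra | | lra].
    apply (solution_periodic omega0 eps a0 U (Derive U)); auto; lra. }
  (* The whole turns 2 pi n are removed from the phase, so that only the drift
     n (omega P - 2 pi) remains. *)
  assert (EV : V (om * t) = V (om * tau + INR n * (om * P - 2 * PI))).
  { replace (om * t) with
      (om * tau + INR n * (om * P - 2 * PI) + 2 * INR n * PI) by (rewrite Et; ring).
    unfold V; rewrite cos_period, Hvper; reflexivity. }
  assert (LV : Rabs (V (om * tau) - V (om * t)) <=
                 (a0 + M) * (2 * omega0 * K2) * eps ^ 2).
  { rewrite EV.
    eapply Rle_trans; [apply (MVT_bound V V1 (a0 + M)); [exact HV|]|].
    - intro s; destruct (Hv s) as (_ & _ & _ & B); unfold V1.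
      eapply Rle_trans; [apply Rabs_triang|].
      rewrite !Rabs_mult, Rabs_Ropp, (Rabs_pos_eq a0), (Rabs_pos_eq eps) by lra.
      assert (Rabs (sin s) <= 1) by apply Rabs_le, SIN_bound.
      pose proof (Rabs_pos (dv1 s)); nra.
    - rewrite Rmult_assoc; apply Rmult_le_compat_l; [lra|].
      replace (om * tau - _) with (- (INR n * (om * P - 2 * PI))) by ring.
      pose proof (pos_INR n) as Hn0.
      rewrite Rabs_Ropp, Rabs_mult, (Rabs_pos_eq (INR n)) by assumption.
      specialize (Hper eps Heps); fold om P in Hper.
      apply Rle_trans with (INR n * (K2 * eps ^ 3));
        [apply Rmult_le_compat_l; assumption|].
      assert (HN : INR n * eps <= 2 * omega0).
      { assert (INR n * / omega0 <= 2 / eps) by nra.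
        apply (Rmult_le_reg_r (/ omega0 * / eps));
          [apply Rmult_lt_0_compat; [|apply Rinv_0_lt_compat]; lra|].
        replace (INR n * eps * (/ omega0 * / eps)) with (INR n * / omega0)
          by (field; lra).
        replace (2 * omega0 * (/ omega0 * / eps)) with (2 / eps) by (field; lra).
        assumption. }
      replace (INR n * (K2 * eps ^ 3)) with (INR n * eps * (K2 * eps ^ 2)) by ring.
      replace (2 * omega0 * K2 * eps ^ 2) with (2 * omega0 * (K2 * eps ^ 2)) by ring.
      apply Rmult_le_compat_r; [|assumption].
      apply Rmult_le_pos; [assumption | apply pow2_ge_0]. }
  replace (r t) with (r tau + (V (om * tau) - V (om * t)))
    by (unfold r; rewrite EU; ring).
  eapply Rle_trans; [apply Rabs_triang|].
  specialize (Hone tau Htau); unfold C0; lra. }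
assert (Heps2 : 0 < eps ^ 2) by (apply pow_lt; lra).
(* The equation for r gives r2 from r. *)
assert (Hall2 : forall t, 0 <= t <= 2 / eps -> Rabs (r2 t) <= C2 * eps ^ 2).
{ intros t Ht; specialize (Hall t Ht); specialize (Hode_r t).
  replace (r2 t) with ((r2 t + omega0 ^ 2 * r t) + - (omega0 ^ 2 * r t)) by ring.
  eapply Rle_trans; [apply Rabs_triang|].
  rewrite Rabs_Ropp, Rabs_mult, (Rabs_pos_eq (omega0 ^ 2)) by lra.
  pose proof (Rabs_pos (r t)); unfold C2; nra. }
assert (Hinv : 1 < / eps) by (rewrite <- Rinv_1; apply Rinv_lt_contravar; lra).
apply (C2_norm_le (1 / eps) _ r r1 r2 Hr Hr1).
- intro t.
  (* r2 is continuous although |cos| and pos_part are not differentiable. *)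
  assert (Er2 : forall x : R, - (omega0 ^ 2 + eps / 2) * U x + - (eps / 2) * Rabs (U x)
    + om ^ 2 * V (om * x)
    + om ^ 2 * eps * (a0 / (2 * omega0 ^ 2)) * Rabs (cos (om * x)) = r2 x).
  { intro x; unfold r2, V, V2; rewrite pos_part_abs; field; lra. }
  apply (continuous_ext _ _ t Er2).
  assert (CU : continuous U t)
    by apply (ex_derive_continuous (K := R_AbsRing) (V := R_NormedModule) U t), Hu1.
  repeat apply @continuous_plus; apply @continuous_scal_r.
  + exact CU.
  + apply continuous_Rabs_comp, CU.
  + apply (ex_derive_continuous (K := R_AbsRing) (V := R_NormedModule)
             (fun t => V (om * t))).
    auto_derive; exists (V1 (om * t)); apply HV.
  + apply continuous_Rabs_comp.
    apply (ex_derive_continuous (K := R_AbsRing) (V := R_NormedModule)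
             (fun t => cos (om * t))).
    auto_derive; trivial.
- intros t Ht; unfold Rdiv in *.
  assert (B0 := Hall t ltac:(lra)); assert (B2 := Hall2 t ltac:(lra)).
  split; [nra|]; split; [|nra].
  replace ((2 * C0 + C2) * eps ^ 2) with (2 * (C0 * eps ^ 2) + C2 * eps ^ 2) by ring.
  apply (landau_derivative_bound r r1 r2); auto.
  intros s Hs; split; [apply Hall | apply Hall2]; lra.
Qed.
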